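(* Let $P=\{P_n(x)\}_{n=0}^{\infty}$ be an orthogonal polynomial sequence on the real line, with orthogonality interval $I=(l,r)\subseteq\mathbb{R}$ and weight function $w$, so that $\int_l^r P_m(x)P_n(x)w(x)\,dx=K_m\delta_{m,n}$ with $K_m>0$ for all $m,n\ge 0$, and suppose that $w$ does not vanish on $I$. Let $M(x)=\frac{ax+b}{cx+d}$, with $a,b,c,d\in\mathbb{C}$ and $\Delta=ad-bc\neq 0$, let $W(x)=-\frac{dx-b}{cx-a}$ be its inverse, and set $R_n(x)=P_n(M(x))$ and $Q_n(x)=(cx+d)^nP_n(M(x))$. Let $\Gamma=\{W(x): l<x<r\}\subset\mathbb{C}_\infty$, which is a curve (part of a straight line or of a circle) with initial point $\lambda=W(l)$ and final point $\rho=W(r)$. Define on $\Gamma$ $$\omega(x)=w(M(x))M'(x)=\Delta\frac{w(M(x))}{(cx+d)^2},\qquad \omega_{m,n}(x)=\frac{\omega(x)}{(cx+d)^{m+n}}.$$ Then for all $m,n\ge 0$ $$\int_\Gamma R_m(x)R_n(x)\omega(x)\,dx=K_m\delta_{m,n}\qquad\text{and}\qquad \int_\Gamma Q_m(x)Q_n(x)\omega_{m,n}(x)\,dx=K_m\delta_{m,n}.$$ Moreover, $\omega$ and $\omega_{m,n}$ do not vanish along $\Gamma$, except at infinity.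
   Context: $\mathbb{C}_\infty=\mathbb{C}\cup\{\infty\}$ is the extended complex plane. $M$ and $W$ are regarded as mutually inverse bijections of $\mathbb{C}_\infty$, with $M(-d/c)=\infty$, $M(\infty)=a/c$, $W(a/c)=\infty$, $W(\infty)=-d/c$. An orthogonal polynomial sequence on the real line is a sequence of real polynomials $P_n$ with $\deg P_n=n$, orthogonal with respect to a continuous non-negative weight function $w$ on an interval $(l,r)$ (finite, semi-infinite or infinite), with all the integrals $\int_l^r P_mP_nw\,dx$ convergent. The integrals over $\Gamma$ are complex contour integrals along $\Gamma$ with the orientation from $\lambda$ to $\rho$ induced by the parametrization $x\mapsto W(x)$, $x\in(l,r)$. If $a/c\in(l,r)$, then $\Gamma$ passes through $\infty$ and consists in $\mathbb{C}$ of two disjoint unbounded pieces of a straight line (one from $\lambda$ to infinity and one from infinity to $\rho$), and the integral is the sum over the two pieces. *)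

(* Defs.v *)
From Stdlib Require Import Reals.
From Coquelicot Require Import Coquelicot.

Open Scope R_scope.

Definition in_interval (l r : Rbar) (x : R) : Prop :=
  Rbar_lt l x /\ Rbar_lt x r.

(* One-sided filters at the ends of the open interval (l, r); they coincide
   with [at_right] / [at_left] at a finite end. *)
Definition left_end (l : Rbar) : (R -> Prop) -> Prop :=
  within (fun x : R => Rbar_lt l x) (Rbar_locally l).
Definition right_end (r : Rbar) : (R -> Prop) -> Prop :=
  within (fun x : R => Rbar_lt x r) (Rbar_locally r).

Definition kronecker (m n : nat) : R := if Nat.eqb m n then 1 else 0.

(* A polynomial is given by its coefficients: [u] and [n] stand for
   u 0 + u 1 x + ... + u n x^n, evaluated at a real or at a complex point. *)
Definition rpoly (u : nat -> R) (n : nat) (x : R) : R :=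
  sum_n (fun k => u k * x ^ k) n.
Definition cpoly (u : nat -> R) (n : nat) (z : C) : C :=
  sum_n (fun k => (RtoC (u k) * Cpow z k)%C) n.

(* [P n] is the coefficient sequence of the n-th polynomial; coefficients
   [P n k] with k > n are ignored. *)
Record orthogonal_polynomials (l r : Rbar) (w : R -> R)
    (P : nat -> nat -> R) (K : nat -> R) : Prop := {
  op_interval : Rbar_lt l r;
  op_weight_continuous : forall x, in_interval l r x -> continuous w x;
  op_weight_ge0 : forall x, in_interval l r x -> 0 <= w x;
  op_degree : forall n, P n n <> 0;
  op_norm_gt0 : forall n, 0 < K n;
  op_orthogonal : forall m n,
    is_RInt_gen (fun x => rpoly (P m) m x * rpoly (P n) n x * w x)
      (left_end l) (right_end r) (K m * kronecker m n)
}.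

Inductive Cinf : Type := Fin (z : C) | Infty.

(* The value at [Infty] is a dummy. *)
Definition fin_part (p : Cinf) : C :=
  match p with Fin z => z | Infty => RtoC 0 end.

Definition Rbar_to_Cinf (x : Rbar) : Cinf :=
  match x with Finite t => Fin (RtoC t) | _ => Infty end.

Definition C_at_infinity (U : C -> Prop) : Prop :=
  exists A : R, forall z : C, A < Cmod z -> U z.

Definition Cinf_locally (p : Cinf) (U : Cinf -> Prop) : Prop :=
  match p with
  | Fin z => locally z (fun y => U (Fin y))
  | Infty => U Infty /\ C_at_infinity (fun y => U (Fin y))
  end.

(* Meaningful only where c z + d <> 0. *)
Definition moebius_fun (a b c d z : C) : C := ((a * z + b) / (c * z + d))%C.

Definition moebius (a b c d : C) (p : Cinf) : Cinf :=
  match p with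
  | Fin z => if Ceq_dec (c * z + d)%C (RtoC 0) then Infty
             else Fin (moebius_fun a b c d z)
  | Infty => if Ceq_dec c (RtoC 0) then Infty else Fin (a / c)%C
  end.

(* W(x) = - (d x - b) / (c x - a) *)
Definition moebius_inv (a b c d : C) : Cinf -> Cinf :=
  moebius (- d)%C b c (- a)%C.

Definition on_line_or_circle (S : Cinf -> Prop) : Prop :=
  (exists (z0 v : C), v <> RtoC 0 /\
     forall z, S (Fin z) -> exists t : R, z = (z0 + RtoC t * v)%C)
  \/
  (exists (z0 : C) (rad : R), 0 < rad /\
     forall p, S p -> exists z, p = Fin z /\ Cmod (z - z0)%C = rad).

(* Improper integral of f dz along a differentiable path g : (l, r) -> C. *)
Definition is_path_int (f : C -> C) (g : R -> C) (l r : Rbar) (J : C) : Prop :=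
  exists g' : R -> C,
    (forall t, in_interval l r t ->
       is_derive (K := R_AbsRing) (V := C_R_NormedModule) g t (g' t)) /\
    is_RInt_gen (V := C_R_NormedModule) (fun t => (f (g t) * g' t)%C)
      (left_end l) (right_end r) J.

(* Contour integral along g : (l, r) -> Cinf; where the contour passes through
   infinity it is the sum over the two resulting pieces. *)
Inductive is_contour_int (f : C -> C) (g : R -> Cinf) (l r : Rbar) :
    C -> Prop :=
| contour_finite : forall J,
    (forall t, in_interval l r t -> g t <> Infty) ->
    is_path_int f (fun t => fin_part (g t)) l r J ->
    is_contour_int f g l r J
| contour_through_infinity : forall (s : R) (J1 J2 : C),
    in_interval l r s -> g s = Infty ->
    (forall t, in_interval l r t -> t <> s -> g t <> Infty) ->
    is_path_int f (fun t => fin_part (g t)) l s J1 ->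
    is_path_int f (fun t => fin_part (g t)) s r J2 ->
    is_contour_int f g l r (J1 + J2)%C.

Definition Gamma_param (a b c d : C) (t : R) : Cinf :=
  moebius_inv a b c d (Fin (RtoC t)).

Definition Gamma (a b c d : C) (l r : Rbar) (p : Cinf) : Prop :=
  exists t : R, in_interval l r t /\ p = Gamma_param a b c d t.

Definition R_fun (P : nat -> nat -> R) (a b c d : C) (n : nat) (z : C) : C :=
  cpoly (P n) n (moebius_fun a b c d z).

(* Agrees with the polynomial Q_n where c z + d <> 0, in particular on the
   finite part of Gamma. *)
Definition Q_fun (P : nat -> nat -> R) (a b c d : C) (n : nat) (z : C) : C :=
  (Cpow (c * z + d) n * cpoly (P n) n (moebius_fun a b c d z))%C.

(* w(M(z)) for z on Gamma, where M(z) is real. *)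
Definition wM (w : R -> R) (a b c d z : C) : C :=
  RtoC (w (Re (moebius_fun a b c d z))).

Definition omega (w : R -> R) (a b c d z : C) : C :=
  ((a * d - b * c) * wM w a b c d z / Cpow (c * z + d) 2)%C.

Definition omega_mn (w : R -> R) (a b c d : C) (m n : nat) (z : C) : C :=
  (omega w a b c d z / Cpow (c * z + d) (m + n))%C.

(* Main.v *)
(* Substituting z = W(t), where M(z) = t and dz = W'(t) dt = dt / M'(z), turns
   each contour integral over Gamma into the integral of P_m P_n w over (l, r);
   the factors (c z + d)^(m+n) of Q_m Q_n and omega_mn cancel. When W has its
   pole s = a/c inside (l, r), the improper integral splits at s, because the
   real integrand is continuous there. *)

Require Import Defs.
From Stdlib Require Import Reals Lra Classical.
From Coquelicot Require Import Coquelicot.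

(** A path integral is by definition an integral in the parameter [t], which is also the variable of
    the orthogonality relation. The substitution therefore amounts to the pointwise identity
    [f (W t) * W' t = h t] off the pole of W, with [h] the real integrand. W is itself a Moebius
    map, with coefficients [- d], [b], [c], [- a] and the same determinant, so each fact about M
    (derivative, continuity, inverse) also serves for W. The delicate point is the split at the
    pole: convergence over (l, r) is one joint limit in both ends, and separate limits at l and at r
    have to be extracted from it. *)

(** * Moduli and neighbourhoods in the complex plane *)

Lemma Cmod_sub_triangle (x y : C) : Cmod x - Cmod y <= Cmod (x - y)%C.
Proof.
generalize (Cmod_triangle (x - y)%C y).
replace (x - y + y)%C with x by ring; lra.
Qed.

Lemma Cmod_sub_comm (x y : C) : Cmod (x - y)%C = Cmod (y - x)%C.
Proof. rewrite <- Cmod_opp; f_equal; ring. Qed.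

(** The uniform balls of [C] are squares, [C] being a product of two lines. The square of half-side
    [delta / sqrt 2] lies in the disc of radius [delta]. *)
Lemma locally_Cmod (z : C) (U : C -> Prop) :
  locally (T := C_UniformSpace) z U <->
  exists delta : posreal, forall y : C, Cmod (y - z)%C < delta -> U y.
Proof.
split.
- intros [delta Hd]; exists delta; intros y Hy.
  apply Hd, C_NormedModule_mixin_compat1, Hy.
- intros [delta Hd].
  assert (H2 : 0 < sqrt 2) by (apply sqrt_lt_R0; lra).
  exists (mkposreal _ (Rdiv_lt_0_compat _ _ (cond_pos delta) H2)).
  intros y Hy; apply Hd.
  apply C_NormedModule_mixin_compat2 in Hy; simpl in Hy.
  replace (sqrt 2 * (delta / sqrt 2)) with (pos delta) in Hy by (field; lra).
  exact Hy.
Qed.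

(** * First-order expansion and derivatives of Moebius maps *)

Lemma moebius_fun_sub (a b c d y z : C) :
  (c * y + d)%C <> 0 -> (c * z + d)%C <> 0 ->
  (moebius_fun a b c d y - moebius_fun a b c d z)%C =
  ((a * d - b * c) * (y - z) / ((c * y + d) * (c * z + d)))%C.
Proof. intros Hy Hz; unfold moebius_fun; field; split; assumption. Qed.

Lemma denominator_near (c d z : C) :
  (c * z + d)%C <> 0 ->
  exists delta : posreal, forall y : C, Cmod (y - z)%C < delta ->
    Cmod (c * z + d)%C / 2 <= Cmod (c * y + d)%C.
Proof.
intros Hz; apply Cmod_gt_0 in Hz.
assert (Hc : 0 < 2 * (Cmod c + 1)) by (generalize (Cmod_ge_0 c); lra).
exists (mkposreal _ (Rdiv_lt_0_compat _ _ Hz Hc)); intros y Hy; simpl in Hy.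
apply Rlt_div_r in Hy; [|exact Hc].
generalize (Cmod_sub_triangle (c * z + d)%C (c * y + d)%C).
replace (c * z + d - (c * y + d))%C with (c * (z - y))%C by ring.
rewrite Cmod_mult, (Cmod_sub_comm z y).
generalize (Cmod_ge_0 (y - z)%C); nra.
Qed.

(** The remainder is exactly [- Delta * c * (y - z)^2 / ((c z + d)^2 * (c y + d))], quadratic in
    [y - z]. Being stated with moduli, the estimate serves the complex derivative, the derivative
    along the real axis and continuity. *)
Lemma moebius_fun_expansion (a b c d z : C) (eps : posreal) :
  (c * z + d)%C <> 0 ->
  exists delta : posreal, forall y : C, Cmod (y - z)%C < delta ->
    Cmod (moebius_fun a b c d y - moebius_fun a b c d z
          - (y - z) * ((a * d - b * c) / (c * z + d) ^ 2))%C
    <= eps * Cmod (y - z)%C.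
Proof.
intros Hz; destruct (denominator_near c d z Hz) as [d1 Hd1].
assert (Hm := proj1 (Cmod_gt_0 _) Hz).
set (m := Cmod (c * z + d)%C) in *.
set (k := Cmod ((a * d - b * c) * c)%C).
assert (Hk : 0 <= k) by apply Cmod_ge_0.
assert (Hq : 0 < m ^ 3) by (apply pow_lt; exact Hm).
(* Since [|c y + d| >= m / 2], the remainder is at most [2 k |y - z|^2 / m^3]; this radius makes it
   at most [eps |y - z|]. The [+ 1] covers [k = 0], that is, [c = 0]. *)
assert (He : 0 < eps * m ^ 3 / (2 * (k + 1))).
{ apply Rdiv_lt_0_compat; [apply Rmult_lt_0_compat; [apply cond_pos|exact Hq]|lra]. }
exists (mkposreal _ (Rmin_pos _ _ (cond_pos d1) He)); intros y Hy; simpl in Hy.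
assert (Hy1 := Rlt_le_trans _ _ _ Hy (Rmin_l _ _)).
assert (Hy2 := Rlt_le_trans _ _ _ Hy (Rmin_r _ _)).
specialize (Hd1 y Hy1); fold m in Hd1.
assert (Hyn : (c * y + d)%C <> 0) by (apply Cmod_gt_0; lra).
rewrite moebius_fun_sub; try assumption.
replace (_ - _)%C with
  (((a * d - b * c) * c) * (z - y) * (y - z) / ((c * z + d) ^ 2 * (c * y + d)))%C
  by (simpl; field; split; assumption).
rewrite Cmod_div, !(Cmod_mult _ (_ - _)), (Cmod_sub_comm z y), (Cmod_mult (_ ^ 2)), Cmod_pow;
  [|apply Cmult_neq_0; [apply Cpow_nz|]; assumption].
fold k m; set (q := Cmod (c * y + d)%C) in *; set (e := Cmod (y - z)%C) in *.
assert (He0 : 0 <= e) by apply Cmod_ge_0.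
assert (Hmm : 0 < m ^ 2) by (apply pow_lt; exact Hm).
apply Rle_div_l; [apply Rmult_lt_0_compat; lra|].
apply Rlt_div_r in Hy2; [|lra].
apply Rle_trans with (eps * e * (m ^ 2 * (m / 2))).
- replace (eps * e * (m ^ 2 * (m / 2))) with (e * (eps * m ^ 3 / 2)) by field.
  replace (k * e * e) with (e * (k * e)) by ring.
  apply Rmult_le_compat_l; [exact He0|nra].
- apply Rmult_le_compat_l; [apply Rmult_le_pos; [left; apply cond_pos|exact He0]|].
  apply Rmult_le_compat_l; lra.
Qed.

Lemma is_derive_moebius_fun (a b c d z : C) :
  (c * z + d)%C <> 0 ->
  is_derive (K := C_AbsRing) (V := C_NormedModule) (moebius_fun a b c d) z
    ((a * d - b * c) / (c * z + d) ^ 2)%C.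
Proof.
intros Hz; split; [apply is_linear_scal_l|].
intros x Hx eps.
rewrite <- (is_filter_lim_locally_unique _ _ Hx).
destruct (moebius_fun_expansion a b c d z eps Hz) as [delta Hd].
exists delta; intros y Hy; exact (Hd y Hy).
Qed.

(** The form that [is_path_int] asks for: real scalars and values in a real module. It is the same
    expansion, restricted to real increments. *)
Lemma is_derive_moebius_fun_R (a b c d : C) (t : R) :
  (c * t + d)%C <> 0 ->
  is_derive (K := R_AbsRing) (V := C_R_NormedModule)
    (fun t => moebius_fun a b c d t) t ((a * d - b * c) / (c * t + d) ^ 2)%C.
Proof.
intros Ht; split; [apply (is_linear_scal_l (K := R_AbsRing))|].
intros x Hx eps.
rewrite <- (is_filter_lim_locally_unique _ _ Hx).
destruct (moebius_fun_expansion a b c d t eps Ht) as [delta Hd].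
exists delta; intros y Hy.
generalize (Hd (RtoC y)); rewrite <- RtoC_minus, Cmod_R; intros Hd'.
specialize (Hd' Hy).
set (D := ((a * d - b * c) / (c * t + d) ^ 2)%C) in *.
rewrite <- scal_R_Cmult in Hd'.
(* The norm of the real module is the Euclidean norm of the pair of coordinates, which is the
   modulus. *)
assert (N : forall u : C_R_NormedModule, norm u = Cmod u).
{ intros u; unfold norm, Cmod; simpl; unfold prod_norm; f_equal.
  unfold norm; simpl; unfold abs; simpl.
  rewrite !Rmult_1_r, <- !Rabs_mult, !Rabs_pos_eq; try apply Rle_0_sqr; reflexivity. }
rewrite N; exact Hd'.
Qed.

(** * Moebius maps as bijections of the extended plane *)

Lemma Cdiv_0_num (x y : C) : (x / y)%C = 0 -> y <> 0 -> x = 0.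
Proof.
intros H Hy; replace x with (x / y * y)%C by (field; exact Hy).
rewrite H; ring.
Qed.

Lemma moebius_denominator_inv (a b c d z : C) :
  (c * z + d)%C <> 0 ->
  (c * moebius_fun a b c d z + - a)%C = (- ((a * d - b * c) / (c * z + d)))%C.
Proof. intros Hz; unfold moebius_fun; field; exact Hz. Qed.

(** The matrix of W is minus the adjugate of that of M; this identity lets the lemmas on [moebius]
    be applied to [moebius_inv]. *)
Lemma moebius_inv_det (a b c d : C) :
  ((- d) * (- a) - b * c)%C = (a * d - b * c)%C.
Proof. ring. Qed.

Lemma Cdiv_neq_0 (x y : C) : x <> 0 -> y <> 0 -> (x / y)%C <> 0.
Proof. intros Hx Hy H; apply Hx, (Cdiv_0_num _ _ H Hy). Qed.

Lemma Copp_neq_0 (x : C) : x <> 0 -> (- x)%C <> 0.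
Proof. intros Hx H; apply Hx; replace x with (- - x)%C by ring; rewrite H; ring. Qed.

Lemma moebius_invK (a b c d : C) (p : Cinf) :
  (a * d - b * c)%C <> 0 ->
  moebius_inv a b c d (moebius a b c d p) = p.
Proof.
intros HD; unfold moebius_inv; destruct p as [z|]; simpl.
- destruct (Ceq_dec (c * z + d)%C 0) as [Hz|Hz]; simpl.
  + destruct (Ceq_dec c 0) as [Hc|Hc].
    * exfalso; apply HD; subst c.
      replace d with (0 * z + d)%C by ring; rewrite Hz; ring.
    * f_equal.
      replace (- d)%C with (c * z - (c * z + d))%C by ring.
      rewrite Hz; field; exact Hc.
  + assert (Hn : (c * moebius_fun a b c d z + - a)%C <> 0).
    { rewrite moebius_denominator_inv by exact Hz.
      apply Copp_neq_0, Cdiv_neq_0; assumption. }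
    destruct (Ceq_dec _ _) as [H|_]; [contradiction|]; f_equal.
    unfold moebius_fun at 1; rewrite moebius_denominator_inv by exact Hz.
    unfold moebius_fun; field; split; [assumption|].
    intros H; apply HD; rewrite <- H; ring.
- destruct (Ceq_dec c 0) as [Hc|Hc]; simpl.
  + destruct (Ceq_dec c 0); [reflexivity|contradiction].
  + destruct (Ceq_dec _ _) as [H|H]; [reflexivity|].
    exfalso; apply H; field; exact Hc.
Qed.

(** Passing to the coefficients of the inverse twice gives back [a b c d] up to double negation, so
    this is [moebius_invK] applied to W. *)
Lemma moebius_invKr (a b c d : C) (p : Cinf) :
  (a * d - b * c)%C <> 0 ->
  moebius a b c d (moebius_inv a b c d p) = p.
Proof.
intros HD.
rewrite <- (moebius_invK (- d)%C b c (- a)%C p) at 2;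
  [|rewrite moebius_inv_det; exact HD].
unfold moebius_inv; f_equal; ring.
Qed.

(** * Continuity on the extended plane *)

(** Compares M(z) with M at infinity. The difference is large near the pole and small near infinity,
    which settles continuity at both points when [c <> 0]. *)
Lemma moebius_fun_sub_limit (a b c d z : C) :
  c <> 0 -> (c * z + d)%C <> 0 ->
  (moebius_fun a b c d z - a / c)%C =
  (- ((a * d - b * c) / (c * (c * z + d))))%C.
Proof. intros Hc Hz; unfold moebius_fun; field; split; assumption. Qed.

Lemma Cmod_affine_lower (c d z : C) :
  Cmod c * Cmod z - Cmod d <= Cmod (c * z + d)%C.
Proof.
generalize (Cmod_sub_triangle (c * z)%C (- d)%C).
rewrite Cmod_mult, Cmod_opp.
replace (c * z - - d)%C with (c * z + d)%C by ring; tauto.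
Qed.

Lemma Cmod_affine_large (c d : C) (A : R) :
  c <> 0 -> exists B : R, forall z : C, B < Cmod z -> A < Cmod (c * z + d)%C.
Proof.
intros Hc; apply Cmod_gt_0 in Hc.
exists ((A + Cmod d) / Cmod c); intros z Hz.
apply Rlt_div_l in Hz; [|exact Hc].
generalize (Cmod_affine_lower c d z); lra.
Qed.

Lemma moebius_continuous (a b c d : C) (p : Cinf) :
  (a * d - b * c)%C <> 0 ->
  filterlim (moebius a b c d) (Cinf_locally p) (Cinf_locally (moebius a b c d p)).
Proof.
intros HD U HU; unfold filtermap; destruct p as [z|]; simpl in HU |- *.
- apply locally_Cmod; destruct (Ceq_dec (c * z + d)%C 0) as [Hz|Hz].
  + destruct HU as [HU1 [A HA]].
    assert (Hc : c <> 0).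
    { intros Hc; apply HD; subst c.
      replace d with (0 * z + d)%C by ring; rewrite Hz; ring. }
    assert (HmD := proj1 (Cmod_gt_0 _) HD).
    assert (Hmc := proj1 (Cmod_gt_0 _) Hc).
    assert (HB : 0 < Rabs A + Cmod (a / c)%C + 1)
      by (generalize (Rabs_pos A), (Cmod_ge_0 (a / c)%C); lra).
    (* At the pole [|c y + d| = |c| |y - z|], so [|M(y) - a/c| = |Delta| / (|c|^2 |y - z|)]. The
       radius makes this exceed [|A| + |a/c| + 1], hence [|M(y)| > A]. *)
    assert (Hd : 0 < Cmod (a * d - b * c)%C / (Rabs A + Cmod (a / c)%C + 1) / (Cmod c * Cmod c))
      by (repeat apply Rdiv_lt_0_compat; try assumption; apply Rmult_lt_0_compat; assumption).
    exists (mkposreal _ Hd); intros y Hy; simpl in Hy.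
    destruct (Ceq_dec (c * y + d)%C 0) as [Hy0|Hy0]; [exact HU1|].
    apply HA.
    generalize (Cmod_sub_triangle (moebius_fun a b c d y - a / c)%C (- (a / c))%C).
    rewrite Cmod_opp.
    replace (moebius_fun a b c d y - a / c - - (a / c))%C
      with (moebius_fun a b c d y) by ring.
    rewrite moebius_fun_sub_limit, Cmod_opp, Cmod_div, Cmod_mult; try assumption;
      [|apply Cmult_neq_0; assumption].
    replace (c * y + d)%C with (c * (y - z))%C
      by (replace (c * (y - z))%C with (c * y + d - (c * z + d))%C by ring;
          rewrite Hz; ring).
    rewrite Cmod_mult.
    assert (He : 0 < Cmod (y - z)%C).
    { apply Cmod_gt_0; intros H; apply Hy0.
      replace (c * y + d)%C with (c * z + d + c * (y - z))%C by ring.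
      rewrite Hz, H; ring. }
    assert (Hcc := Rmult_lt_0_compat _ _ Hmc Hmc).
    apply Rlt_div_r in Hy; [|exact Hcc].
    apply Rlt_div_r in Hy; [|exact HB].
    assert (Rabs A + Cmod (a / c)%C + 1 <
            Cmod (a * d - b * c)%C / (Cmod c * (Cmod c * Cmod (y - z)%C))).
    { apply Rlt_div_r; [repeat apply Rmult_lt_0_compat; assumption|].
      eapply Rle_lt_trans, Hy; right; ring. }
    generalize (Rle_abs A); lra.
  + apply locally_Cmod in HU; destruct HU as [e He].
    destruct (denominator_near c d z Hz) as [d1 Hd1].
    set (k := ((a * d - b * c) / (c * z + d) ^ 2)%C).
    (* With tolerance 1 the expansion becomes a local Lipschitz bound with constant [1 + Cmod k]. *)
    destruct (moebius_fun_expansion a b c d z (mkposreal 1 Rlt_0_1) Hz)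
      as [d2 Hd2]; fold k in Hd2; simpl in Hd2.
    assert (Hk : 0 < 1 + Cmod k) by (generalize (Cmod_ge_0 k); lra).
    exists (mkposreal _ (Rmin_pos _ _ (Rmin_pos _ _ (cond_pos d1) (cond_pos d2))
              (Rdiv_lt_0_compat _ _ (cond_pos e) Hk))).
    intros y Hy; simpl in Hy.
    assert (Hy1 := Rlt_le_trans _ _ _ Hy (Rmin_l _ _)).
    assert (Hye := Rlt_le_trans _ _ _ Hy (Rmin_r _ _)).
    assert (Hy2 := Rlt_le_trans _ _ _ Hy1 (Rmin_r _ _)).
    apply Rlt_le_trans with (2 := Rmin_l _ _) in Hy1.
    specialize (Hd1 y Hy1); specialize (Hd2 y Hy2).
    destruct (Ceq_dec (c * y + d)%C 0) as [Hy0|Hy0].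
    * exfalso; apply Cmod_gt_0 in Hz; rewrite Hy0, Cmod_0 in Hd1; lra.
    * apply He; apply Rlt_div_r in Hye; [|exact Hk].
      apply Rle_trans with (1 := Cmod_sub_triangle _ _) in Hd2.
      rewrite Cmod_mult in Hd2; lra.
- destruct (Ceq_dec c 0) as [Hc|Hc].
  + destruct HU as [HU1 [A HA]]; split; [exact HU1|].
    assert (Ha : a <> 0) by (intros Ha; apply HD; rewrite Ha, Hc; ring).
    assert (Hd : d <> 0) by (intros Hd; apply HD; rewrite Hd, Hc; ring).
    destruct (Cmod_affine_large (a / d)%C (b / d)%C A) as [B HB].
    { apply Cdiv_neq_0; assumption. }
    exists B; intros z Hz.
    destruct (Ceq_dec _ _) as [_|Hy0]; [exact HU1|].
    apply HA; unfold moebius_fun; subst c.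
    replace ((a * z + b) / (0 * z + d))%C with (a / d * z + b / d)%C; [apply HB, Hz|].
    field; exact Hd.
  + apply locally_Cmod in HU; destruct HU as [e He].
    assert (HmD := proj1 (Cmod_gt_0 _) HD).
    assert (Hmc := proj1 (Cmod_gt_0 _) Hc).
    (* The threshold solves [|Delta| / (|c| |c z + d|) < e], the left side being [|M(z) - a/c|]. *)
    destruct (Cmod_affine_large c d (Cmod (a * d - b * c)%C / e / Cmod c) Hc) as [B HB].
    assert (Hpos : 0 < Cmod (a * d - b * c)%C / e / Cmod c)
      by (repeat apply Rdiv_lt_0_compat; try assumption; apply cond_pos).
    split.
    { apply He; replace (a / c - a / c)%C with (RtoC 0) by ring.
      rewrite Cmod_0; apply cond_pos. }
    exists B; intros z Hz; specialize (HB z Hz).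
    destruct (Ceq_dec _ _) as [H0|H0]; [rewrite H0, Cmod_0 in HB; lra|].
    apply He; rewrite moebius_fun_sub_limit, Cmod_opp, Cmod_div, Cmod_mult;
      try assumption; [|apply Cmult_neq_0; assumption].
    apply Rlt_div_l in HB; [|exact Hmc]; apply (proj1 (Rlt_div_l _ _ _ (cond_pos e))) in HB.
    apply Rlt_div_l; [apply Rmult_lt_0_compat; [assumption|apply Cmod_gt_0; exact H0]|].
    eapply Rlt_le_trans; [exact HB|right; ring].
Qed.

Lemma filterlim_Fin_RtoC (t : R) :
  filterlim (fun t : R => Fin (RtoC t)) (locally t) (Cinf_locally (Fin t)).
Proof.
intros U HU; simpl in HU; apply locally_Cmod in HU; destruct HU as [e He].
exists e; intros y Hy; apply He.
rewrite <- RtoC_minus, Cmod_R; exact Hy.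
Qed.

Lemma filterlim_Rbar_to_Cinf (x : Rbar) :
  filterlim (fun t : R => Fin (RtoC t)) (Rbar_locally x)
    (Cinf_locally (Rbar_to_Cinf x)).
Proof.
destruct x as [t| |].
- exact (filterlim_Fin_RtoC t).
- intros U [_ [A HA]]; exists (Rmax A 0); intros t Ht; apply HA.
  rewrite Cmod_R; eapply Rlt_le_trans, Rle_abs.
  eapply Rle_lt_trans; [apply Rmax_l|exact Ht].
- intros U [_ [A HA]]; exists (- Rmax A 0); intros t Ht; apply HA.
  rewrite Cmod_R, <- Rabs_Ropp; eapply Rlt_le_trans, Rle_abs.
  generalize (Rmax_l A 0); lra.
Qed.

(** Taking [x] in [Rbar] covers interior parameters as well as both ends, infinite or not, where the
    limits are λ and ρ. *)
Lemma Gamma_param_continuous (a b c d : C) (x : Rbar) :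
  (a * d - b * c)%C <> 0 ->
  filterlim (Gamma_param a b c d) (Rbar_locally x)
    (Cinf_locally (moebius_inv a b c d (Rbar_to_Cinf x))).
Proof.
intros HD; refine (filterlim_comp _ _ _ _ _ _ _ _ (filterlim_Rbar_to_Cinf x) _).
apply moebius_continuous; rewrite moebius_inv_det; exact HD.
Qed.

(** * The curve Γ and its shape *)

Lemma Gamma_param_Fin (a b c d z : C) (t : R) :
  Gamma_param a b c d t = Fin z ->
  (c * t + - a)%C <> 0 /\ z = moebius_fun (- d) b c (- a) t.
Proof.
unfold Gamma_param, moebius_inv; simpl; intros H.
destruct (Ceq_dec _ _) as [|Hn]; [discriminate|].
injection H as <-; auto.
Qed.

Lemma Gamma_param_Infty (a b c d : C) (t : R) :
  Gamma_param a b c d t = Infty -> (c * t + - a)%C = 0.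
Proof.
unfold Gamma_param, moebius_inv; simpl.
destruct (Ceq_dec _ _); [trivial|discriminate].
Qed.

Lemma moebius_denominator_Gamma (a b c d : C) (t : R) :
  (c * t + - a)%C <> 0 ->
  (c * moebius_fun (- d) b c (- a) t + d)%C =
  (- ((a * d - b * c) / (c * t + - a)))%C.
Proof. intros Ht; unfold moebius_fun; field; exact Ht. Qed.

Lemma moebius_denominator_Gamma_neq_0 (a b c d : C) (t : R) :
  (a * d - b * c)%C <> 0 -> (c * t + - a)%C <> 0 ->
  (c * moebius_fun (- d) b c (- a) t + d)%C <> 0.
Proof.
intros HD Ht; rewrite moebius_denominator_Gamma by exact Ht.
apply Copp_neq_0, Cdiv_neq_0; assumption.
Qed.

Lemma moebius_fun_Gamma (a b c d : C) (t : R) :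
  (a * d - b * c)%C <> 0 -> (c * t + - a)%C <> 0 ->
  moebius_fun a b c d (moebius_fun (- d) b c (- a) t) = t.
Proof.
intros HD Ht; unfold moebius_fun at 1.
rewrite moebius_denominator_Gamma by exact Ht.
unfold moebius_fun; field; split; [exact Ht|].
intros H; apply HD; rewrite <- H; ring.
Qed.

Lemma RtoC_sub_neq_0 (s : C) (t : R) : Im s <> 0 -> (t - s)%C <> 0.
Proof.
destruct s as [x y]; intros Hs H; apply Hs.
apply (f_equal Im) in H; simpl in H |- *; lra.
Qed.

Lemma Cconj_sub_neq_0 (s : C) : Im s <> 0 -> (Cconj s - s)%C <> 0.
Proof.
destruct s as [x y]; intros Hs H; apply Hs.
apply (f_equal Im) in H; simpl in H |- *; lra.
Qed.

(* Inversion in a point [s] off the real axis maps the axis to a circle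
   through 0 with centre [/ (Cconj s - s)]: the distance is
   [|t - Cconj s| / (|t - s| |Cconj s - s|)] and [|t - Cconj s| = |t - s|]. *)
Lemma Cinv_real_axis_circle (s : C) (t : R) :
  Im s <> 0 ->
  Cmod (/ (t - s) - / (Cconj s - s))%C = / Cmod (Cconj s - s)%C.
Proof.
intros Hs.
assert (Ht := RtoC_sub_neq_0 s t Hs); assert (Hc := Cconj_sub_neq_0 s Hs).
replace (/ (t - s) - / (Cconj s - s))%C
  with ((- Cconj (t - s)) / (t - s) / (Cconj s - s))%C.
- rewrite !Cmod_div, Cmod_opp, Cmod_conj by assumption.
  field; split; apply Rgt_not_eq, Cmod_gt_0; assumption.
- rewrite Cminus_conj.
  replace (Cconj t) with (RtoC t) by (apply injective_projections; simpl; ring).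
  field; split; assumption.
Qed.

(** For [c <> 0], partial fractions at the pole [s = a / c] give [W(t) = - d / c + k / (t - s)] with
    [k = - Delta / c^2]: an inversion followed by a similarity. A real [s] keeps [1 / (t - s)] real
    and yields a line; otherwise a circle arises. *)
Lemma Gamma_on_line_or_circle (a b c d : C) (l r : Rbar) :
  (a * d - b * c)%C <> 0 -> on_line_or_circle (Gamma a b c d l r).
Proof.
intros HD; destruct (Ceq_dec c 0) as [Hc|Hc].
- left; subst c.
  assert (Ha : a <> 0) by (intros Ha; apply HD; rewrite Ha; ring).
  assert (Hd : d <> 0) by (intros Hd; apply HD; rewrite Hd; ring).
  exists (- (b / a))%C, (d / a)%C; split; [apply Cdiv_neq_0; assumption|].
  intros z [t [_ Ht]]; exists t.
  symmetry in Ht; apply Gamma_param_Fin in Ht; destruct Ht as [_ ->].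
  unfold moebius_fun; field; exact Ha.
- assert (Has : exists s, a = (c * s)%C) by (exists (a / c)%C; field; exact Hc).
  destruct Has as [s ->].
  assert (Hs : forall t : R, (c * t + - (c * s))%C = (c * (t - s))%C)
    by (intros t; ring).
  set (k := (- ((s * d - b) / c))%C).
  assert (Hk : k <> 0).
  { apply Copp_neq_0, Cdiv_neq_0; [|exact Hc].
    intros H; apply HD; replace (c * s * d - b * c)%C with (c * (s * d - b))%C by ring.
    rewrite H; ring. }
  assert (HG : forall t z, Gamma_param (c * s) b c d t = Fin z ->
    (t - s)%C <> 0 /\ z = (- (d / c) + / (t - s) * k)%C).
  { intros t z Ht; apply Gamma_param_Fin in Ht; destruct Ht as [Hn ->].
    rewrite Hs in Hn.
    assert (Hts : (t - s)%C <> 0) by (intros H; apply Hn; rewrite H; ring).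
    split; [exact Hts|].
    unfold moebius_fun, k; rewrite Hs; field; split; assumption. }
  destruct (Req_dec (Im s) 0) as [Him|Him].
  + left; exists (- (d / c))%C, k; split; [exact Hk|].
    intros z [t [_ Ht]]; exists (/ (t - Re s)).
    symmetry in Ht; apply HG in Ht; destruct Ht as [Hts ->].
    assert (Hre : s = RtoC (Re s))
      by (destruct s as [x y]; simpl in Him; subst y; reflexivity).
    rewrite Hre, <- RtoC_minus in Hts |- *; simpl Re.
    rewrite RtoC_inv; [reflexivity|].
    intros H; apply Hts; rewrite H; reflexivity.
  (* Centre and radius are the images under the similarity of those of the circle traced by
     [/ (t - s)]. *)
  + right; exists (- (d / c) + / (Cconj s - s) * k)%C, (/ Cmod (Cconj s - s) * Cmod k).
    split.
    { apply Rmult_lt_0_compat; [apply Rinv_0_lt_compat|]; apply Cmod_gt_0;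
        [apply Cconj_sub_neq_0|]; assumption. }
    intros p [t [_ ->]]; destruct (Gamma_param (c * s) b c d t) as [z|] eqn:Ht.
    * exists z; split; [reflexivity|].
      apply HG in Ht; destruct Ht as [Hts ->].
      rewrite <- (Cinv_real_axis_circle s t Him), <- Cmod_mult; f_equal; ring.
    * exfalso; apply Gamma_param_Infty in Ht; rewrite Hs in Ht.
      exact (Cmult_neq_0 _ _ Hc (RtoC_sub_neq_0 s t Him) Ht).
Qed.

(** * End filters and the splitting of improper integrals *)

(** No real exceeds [p_infty], so there the side condition is empty and the filter contains the
    empty set. *)
Lemma left_end_proper (l : Rbar) : l <> p_infty -> ProperFilter (left_end l).
Proof.
intros Hl; split; [|apply within_filter, Rbar_locally_filter].
intros P HP; unfold left_end, within in HP; destruct l as [l| |]; [|easy|].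
- destruct HP as [e He]; exists (l + e / 2); assert (H := cond_pos e).
  apply He; [|simpl; lra].
  apply Rabs_lt_between'; simpl; lra.
- destruct HP as [A HA]; exists (A - 1); apply HA; [lra|exact I].
Qed.

Lemma right_end_proper (r : Rbar) : r <> m_infty -> ProperFilter (right_end r).
Proof.
intros Hr; split; [|apply within_filter, Rbar_locally_filter].
intros P HP; unfold right_end, within in HP; destruct r as [r| |]; [| |easy].
- destruct HP as [e He]; exists (r - e / 2); assert (H := cond_pos e).
  apply He; [|simpl; lra].
  apply Rabs_lt_between'; simpl; lra.
- destruct HP as [A HA]; exists (A + 1); apply HA; [lra|exact I].
Qed.

Lemma left_end_in_interval (l r : Rbar) :
  Rbar_lt l r -> left_end l (in_interval l r).
Proof.
intros Hlr; unfold left_end, within.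
apply filter_imp with (fun x : R => Rbar_lt x r); [intros x; split; assumption|].
destruct l as [l| |]; destruct r as [r| |]; try easy.
- exact (open_lt r l Hlr).
- now apply filter_forall.
- now exists r.
- now apply filter_forall.
Qed.

Lemma right_end_in_interval (l r : Rbar) :
  Rbar_lt l r -> right_end r (in_interval l r).
Proof.
intros Hlr; unfold right_end, within.
apply filter_imp with (fun x : R => Rbar_lt l x); [intros x; split; assumption|].
destruct l as [l| |]; destruct r as [r| |]; try easy.
- exact (open_gt l r Hlr).
- now exists l.
- now apply filter_forall.
- now apply filter_forall.
Qed.

Lemma open_in_interval (l r : Rbar) : open (in_interval l r).
Proof. apply open_and; [apply open_Rbar_gt|apply open_Rbar_lt]. Qed.

Lemma in_interval_convex (l r : Rbar) (x y z : R) :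
  in_interval l r x -> in_interval l r y -> Rmin x y <= z <= Rmax x y ->
  in_interval l r z.
Proof.
intros [Hx1 Hx2] [Hy1 Hy2] [Hz1 Hz2]; split.
- apply Rbar_lt_le_trans with (Finite (Rmin x y)); [|exact Hz1].
  apply Rmin_case; assumption.
- apply Rbar_le_lt_trans with (Finite (Rmax x y)); [exact Hz2|].
  apply Rmax_case; assumption.
Qed.

Lemma is_RInt_gen_primitive (f G : R -> R) (Fa Fb : (R -> Prop) -> Prop)
    (FFa : Filter Fa) (FFb : Filter Fb) (A B : R) :
  filter_prod Fa Fb (fun ab => is_RInt f (fst ab) (snd ab) (G (snd ab) - G (fst ab))) ->
  filterlim G Fa (locally A) -> filterlim G Fb (locally B) ->
  is_RInt_gen f Fa Fb (B - A).
Proof.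
intros HG HA HB.
apply (filterlimi_lim_ext_loc (fun ab => G (snd ab) - G (fst ab))); [exact HG|].
apply (filterlim_comp_2 (G := locally B) (H := locally (- A))
  (fun ab => G (snd ab)) (fun ab => - G (fst ab)) Rplus).
- exact (filterlim_comp _ _ _ _ _ _ _ _ filterlim_snd HB).
- refine (filterlim_comp _ _ _ (fun ab => G (fst ab)) Ropp _ _ _ _ (filterlim_opp A)).
  exact (filterlim_comp _ _ _ _ _ _ _ _ filterlim_fst HA).
- exact (filterlim_plus B (- A)).
Qed.

(** Take the primitive [G] of [f] vanishing at [s]. The hypothesis says that [G y - G x] tends to
    [J] as [x] and [y] approach the two ends jointly; completeness of the reals separates this into
    a limit [B] at [r] and [B - J] at [l]. *)
Lemma is_RInt_gen_split (f : R -> R) (l r : Rbar) (s J : R) :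
  (forall x, in_interval l r x -> continuous f x) -> in_interval l r s ->
  is_RInt_gen f (left_end l) (right_end r) J ->
  exists J1 J2, J = J1 + J2 /\
    is_RInt_gen f (left_end l) (right_end s) J1 /\
    is_RInt_gen f (left_end s) (right_end r) J2.
Proof.
intros Hf Hs HJ.
assert (Hls := proj1 Hs); assert (Hsr := proj2 Hs).
assert (Hlr := Rbar_lt_trans _ _ _ Hls Hsr).
assert (Pl : ProperFilter (left_end l)) by (apply left_end_proper; now intros ->).
assert (Pr : ProperFilter (right_end r))
  by (apply right_end_proper; intros ->; now destruct l).
assert (Fl' : Filter (left_end s)) by apply within_filter, Rbar_locally_filter.
assert (Fr' : Filter (right_end s)) by apply within_filter, Rbar_locally_filter.
set (G := RInt f s).
assert (HGs : forall x, in_interval l r x -> is_RInt f s x (G x)).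
{ intros x Hx; apply (RInt_correct f), (ex_RInt_continuous f).
  intros z Hz; apply Hf, (in_interval_convex l r s x); assumption. }
assert (HG : forall x y, in_interval l r x -> in_interval l r y ->
  is_RInt f x y (G y - G x)).
{ intros x y Hx Hy; unfold Rminus; rewrite Rplus_comm.
  apply (is_RInt_Chasles f x s y); [apply (is_RInt_swap f)|]; apply HGs; assumption. }
assert (HGlim : forall eps : posreal, filter_prod (left_end l) (right_end r)
  (fun ab => Rabs (G (snd ab) - G (fst ab) - J) < eps)).
{ intros eps.
  assert (HI : filter_prod (left_end l) (right_end r)
    (fun ab => in_interval l r (fst ab) /\ in_interval l r (snd ab))).
  { exists (in_interval l r) (in_interval l r);
      [apply left_end_in_interval|apply right_end_in_interval|]; auto. }
  apply filter_imp with (2 := filter_and _ _ HI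
    (proj1 (filterlimi_locally _ J) HJ eps)).
  intros [x y] [[Hx Hy] [z [Hz Hb]]]; simpl in *.
  rewrite <- (is_RInt_unique _ _ _ _ (HG x y Hx Hy)), (is_RInt_unique _ _ _ _ Hz).
  exact Hb. }
assert (HB : exists B : R, filterlim G (right_end r) (locally B)).
{ apply (filterlim_locally_cauchy (U := R_CompleteSpace) G); intros eps.
  destruct (HGlim (pos_div_2 eps)) as [P Q HP HQ HPQ].
  (* One [x] near [l] is kept fixed: [G u - G x] and [G v - G x] are both close to [J], so [G u] and
     [G v] are close to each other. *)
  destruct (filter_ex _ HP) as [x Hx].
  exists Q; split; [exact HQ|]; intros u v Hu Hv.
  assert (H1 := HPQ x u Hx Hu); assert (H2 := HPQ x v Hx Hv); simpl in H1, H2.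
  change (Rabs (G v - G u) < eps).
  apply Rabs_lt_between in H1; apply Rabs_lt_between in H2.
  apply Rabs_lt_between; lra. }
destruct HB as [B HB].
assert (HA : filterlim G (left_end l) (locally (B - J))).
{ apply filterlim_locally; intros eps.
  destruct (HGlim (pos_div_2 eps)) as [P Q HP HQ HPQ].
  destruct (filter_ex _ (filter_and _ _ HQ
    (proj1 (filterlim_locally G B) HB (pos_div_2 eps)))) as [y [Hy HyB]].
  apply filter_imp with (2 := HP); intros x Hx.
  assert (H1 := HPQ x y Hx Hy); simpl in H1.
  change (Rabs (G y - B) < eps / 2) in HyB.
  change (Rabs (G x - (B - J)) < eps).
  apply Rabs_lt_between in H1; apply Rabs_lt_between in HyB.
  apply Rabs_lt_between; lra. }
assert (HGc : filterlim G (locally s) (locally 0)).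
{ replace 0 with (G s) by apply (RInt_point s f).
  apply (ex_derive_continuous G s); exists (f s).
  apply (is_derive_RInt f G s s); [|exact (Hf s Hs)].
  apply filter_imp with (2 := open_in_interval l r s Hs), HGs. }
(* Each piece is a difference of limits of [G], with limit 0 at [s] from either side. *)
exists (0 - (B - J)), (B - 0); split; [ring|split];
  apply (is_RInt_gen_primitive f G); try assumption; try typeclasses eauto.
- exists (in_interval l s) (in_interval l s);
    [apply left_end_in_interval, Hls|apply right_end_in_interval, Hls|].
  intros x y [Hx1 Hx2] [Hy1 Hy2]; apply HG; split; try assumption.
  + apply Rbar_lt_trans with (Finite s); assumption.
  + apply Rbar_lt_trans with (Finite s); assumption.
- apply filterlim_filter_le_1 with (2 := HGc), filter_le_within.
- exists (in_interval s r) (in_interval s r);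
    [apply left_end_in_interval, Hsr|apply right_end_in_interval, Hsr|].
  intros x y [Hx1 Hx2] [Hy1 Hy2]; apply HG; split; try assumption.
  + apply Rbar_lt_trans with (Finite s); assumption.
  + apply Rbar_lt_trans with (Finite s); assumption.
- apply filterlim_filter_le_1 with (2 := HGc), filter_le_within.
Qed.

(** * Contour integrals over Γ as real integrals *)

Lemma is_RInt_RtoC (f : R -> R) (x y J : R) :
  is_RInt f x y J ->
  is_RInt (V := C_R_NormedModule) (fun t => RtoC (f t)) x y (RtoC J).
Proof.
intros HJ; apply (is_RInt_fct_extend_pair (U := R_NormedModule) (V := R_NormedModule));
  [exact HJ|].
assert (H0 := is_RInt_const (V := R_NormedModule) x y 0).
change (is_RInt (fun _ : R => 0) x y ((y - x) * 0)) in H0.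
rewrite Rmult_0_r in H0; exact H0.
Qed.

Lemma is_RInt_gen_RtoC (f : R -> R) (Fa Fb : (R -> Prop) -> Prop)
    (FFa : Filter Fa) (FFb : Filter Fb) (J : R) :
  is_RInt_gen f Fa Fb J ->
  is_RInt_gen (V := C_R_NormedModule) (fun t => RtoC (f t)) Fa Fb (RtoC J).
Proof.
intros HJ; apply filterlimi_locally; intros eps.
apply filter_imp with (2 := proj1 (filterlimi_locally _ J) HJ eps).
intros ab [z [Hz Hb]]; exists (RtoC z); split; [apply is_RInt_RtoC, Hz|].
split; [exact Hb|apply ball_center].
Qed.

Lemma is_path_int_Gamma (a b c d : C) (f : C -> C) (h : R -> R) (l r : Rbar) (J : R) :
  Rbar_lt l r ->
  (forall t, in_interval l r t -> (c * t + - a)%C <> 0) ->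
  (forall t, in_interval l r t ->
     (f (moebius_fun (- d) b c (- a) t) * ((a * d - b * c) / (c * t + - a) ^ 2))%C
     = RtoC (h t)) ->
  is_RInt_gen h (left_end l) (right_end r) J ->
  is_path_int f (fun t => fin_part (Gamma_param a b c d t)) l r (RtoC J).
Proof.
intros Hlr Hn Hf HJ.
assert (Fl : Filter (left_end l)) by apply within_filter, Rbar_locally_filter.
assert (Fr : Filter (right_end r)) by apply within_filter, Rbar_locally_filter.
assert (Hg : forall t, in_interval l r t ->
  fin_part (Gamma_param a b c d t) = moebius_fun (- d) b c (- a) t).
{ intros t Ht; unfold Gamma_param, moebius_inv; simpl.
  destruct (Ceq_dec _ _) as [H|_]; [destruct (Hn t Ht H)|reflexivity]. }
exists (fun t => ((a * d - b * c) / (c * t + - a) ^ 2)%C); split.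
- intros t Ht.
  (* [Gamma_param] branches on the pole; the interval is open and free of poles, so near [t] it
     coincides with the plain quotient. *)
  apply (is_derive_ext_loc (V := C_R_NormedModule) (fun t => moebius_fun (- d) b c (- a) t)).
  { apply filter_imp with (2 := open_in_interval l r t Ht).
    intros u Hu; symmetry; apply Hg, Hu. }
  rewrite <- moebius_inv_det; apply is_derive_moebius_fun_R, Hn, Ht.
- apply (is_RInt_gen_ext (V := C_R_NormedModule) (fun t => RtoC (h t)));
    [|apply is_RInt_gen_RtoC; assumption].
  exists (in_interval l r) (in_interval l r);
    [apply left_end_in_interval, Hlr|apply right_end_in_interval, Hlr|].
  simpl; intros x y Hx Hy t Ht.
  assert (Hi : in_interval l r t)
    by (apply (in_interval_convex l r x y); try assumption; lra).
  rewrite Hg by exact Hi; symmetry; apply Hf, Hi.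
Qed.

(** Keeping [f] abstract lets one statement serve both orthogonality relations. At the pole [f] is
    unconstrained, while [h] is continuous there, which permits the split. *)
Lemma is_contour_int_Gamma (a b c d : C) (f : C -> C) (h : R -> R) (l r : Rbar) (J : R) :
  (a * d - b * c)%C <> 0 -> Rbar_lt l r ->
  (forall t, in_interval l r t -> continuous h t) ->
  (forall t, in_interval l r t -> (c * t + - a)%C <> 0 ->
     (f (moebius_fun (- d) b c (- a) t) * ((a * d - b * c) / (c * t + - a) ^ 2))%C
     = RtoC (h t)) ->
  is_RInt_gen h (left_end l) (right_end r) J ->
  is_contour_int f (Gamma_param a b c d) l r (RtoC J).
Proof.
intros HD Hlr Hc Hf HJ.
destruct (classic (exists s, in_interval l r s /\ Gamma_param a b c d s = Infty))
  as [[s [Hs Hinf]]|Hfin].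
- destruct (is_RInt_gen_split h l r s J Hc Hs HJ) as (J1 & J2 & -> & HJ1 & HJ2).
  (* The pole is unique: two distinct zeros of [c t - a] would force [c = a = 0], hence zero
     determinant. *)
  assert (Hne : forall t : R, t <> s -> (c * t + - a)%C <> 0).
  { intros t Hts H; apply Gamma_param_Infty in Hinf.
    assert (Hts' : (t - s)%C <> 0).
    { intros E; apply Hts; rewrite <- RtoC_minus in E; apply RtoC_inj in E; lra. }
    assert (Hc0 : c = 0).
    { replace c with ((c * t + - a - (c * s + - a)) / (t - s))%C
        by (field; exact Hts').
      rewrite H, Hinf; field; exact Hts'. }
    apply HD; replace a with (c * s - (c * s + - a))%C by ring.
    rewrite Hinf, Hc0; ring. }
  assert (Hl : forall t, in_interval l s t -> in_interval l r t /\ t <> s).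
  { intros t [Ht1 Ht2]; split; [|simpl in Ht2; lra].
    split; [exact Ht1|apply Rbar_lt_trans with (Finite s); [exact Ht2|apply Hs]]. }
  assert (Hr : forall t, in_interval s r t -> in_interval l r t /\ t <> s).
  { intros t [Ht1 Ht2]; split; [|simpl in Ht1; lra].
    split; [apply Rbar_lt_trans with (Finite s); [apply Hs|exact Ht1]|exact Ht2]. }
  rewrite RtoC_plus; apply contour_through_infinity with s; try assumption.
  + intros t _ Hts H; exact (Hne t Hts (Gamma_param_Infty _ _ _ _ _ H)).
  + apply (is_path_int_Gamma a b c d f h); try assumption; [apply Hs|..];
      intros t Ht; apply Hl in Ht; destruct Ht as [Ht Hts]; auto.
  + apply (is_path_int_Gamma a b c d f h); try assumption; [apply Hs|..];
      intros t Ht; apply Hr in Ht; destruct Ht as [Ht Hts]; auto.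
- assert (Hn : forall t, in_interval l r t -> (c * t + - a)%C <> 0).
  { intros t Ht H; apply Hfin; exists t; split; [exact Ht|].
    unfold Gamma_param, moebius_inv; simpl.
    destruct (Ceq_dec _ _); [reflexivity|contradiction]. }
  apply contour_finite.
  + intros t Ht H; apply Hfin; exists t; auto.
  + apply (is_path_int_Gamma a b c d f h); auto.
Qed.

(** * Polynomials and weights on Γ *)

Lemma cpoly_RtoC (u : nat -> R) (n : nat) (x : R) :
  cpoly u n (RtoC x) = RtoC (rpoly u n x).
Proof.
unfold cpoly, rpoly; induction n as [|n IHn].
- rewrite !sum_O, RtoC_mult, RtoC_pow; reflexivity.
- rewrite !sum_Sn, IHn.
  change (plus ?x ?y) with (x + y)%C at 1.
  change (plus ?x ?y) with (x + y) .
  rewrite RtoC_plus, RtoC_mult, RtoC_pow; reflexivity.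
Qed.

Lemma continuous_rpoly (u : nat -> R) (n : nat) (x : R) : continuous (rpoly u n) x.
Proof.
assert (Hm : forall k, continuous (fun x => u k * x ^ k) x).
{ intros k; apply (ex_derive_continuous (fun x => u k * x ^ k)).
  auto_derive; exact I. }
induction n as [|n IHn].
- apply continuous_ext with (fun x => u O * x ^ O); [|apply Hm].
  intros y; unfold rpoly; rewrite sum_O; reflexivity.
- apply continuous_ext with (fun x => plus (rpoly u n x) (u (S n) * x ^ S n)).
  + intros y; unfold rpoly; rewrite sum_Sn; reflexivity.
  + apply (continuous_plus (rpoly u n)); auto.
Qed.

(** The right side is [w t / W' t], because [M'(W t) = 1 / W' t]; the factor [dz] of the contour
    integral cancels it to [w t]. *)
Lemma omega_Gamma (w : R -> R) (a b c d : C) (t : R) :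
  (a * d - b * c)%C <> 0 -> (c * t + - a)%C <> 0 ->
  omega w a b c d (moebius_fun (- d) b c (- a) t) =
  (w t * (c * t + - a) ^ 2 / (a * d - b * c))%C.
Proof.
intros HD Ht; unfold omega, wM.
rewrite moebius_fun_Gamma, moebius_denominator_Gamma by assumption.
simpl; field; split; assumption.
Qed.

Lemma omega_neq_0 (w : R -> R) (a b c d z : C) (l r : Rbar) :
  (forall x, in_interval l r x -> w x <> 0) -> (a * d - b * c)%C <> 0 ->
  Gamma a b c d l r (Fin z) -> omega w a b c d z <> 0.
Proof.
intros Hw HD [t [Ht Hz]]; symmetry in Hz; apply Gamma_param_Fin in Hz.
destruct Hz as [Hn ->]; rewrite omega_Gamma by assumption.
apply Cdiv_neq_0; [|exact HD]; apply Cmult_neq_0; [|apply Cpow_nz, Hn].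
intros H; apply (Hw t Ht), RtoC_inj, H.
Qed.

Lemma Gamma_denominator_neq_0 (a b c d z : C) (l r : Rbar) :
  (a * d - b * c)%C <> 0 -> Gamma a b c d l r (Fin z) -> (c * z + d)%C <> 0.
Proof.
intros HD [t [_ Hz]]; symmetry in Hz; apply Gamma_param_Fin in Hz.
destruct Hz as [Hn ->]; apply moebius_denominator_Gamma_neq_0; assumption.
Qed.

(* Near infinity on Gamma the parameter [t = M z] is close to [a / c], so
   [w (M z)] stays bounded while [c z + d] tends to infinity. *)
Lemma omega_mn_vanishes_at_infinity (w : R -> R) (a b c d : C) (l r : Rbar) (m n : nat) :
  (forall x, in_interval l r x -> continuous w x) -> (a * d - b * c)%C <> 0 ->
  Gamma a b c d l r Infty ->
  filterlim (omega_mn w a b c d m n)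
    (within (fun z => Gamma a b c d l r (Fin z)) C_at_infinity) (locally (RtoC 0)).
Proof.
intros Hw HD [s [Hs Hinf]]; symmetry in Hinf; apply Gamma_param_Infty in Hinf.
assert (Hc : c <> 0).
{ intros Hc; apply HD; replace a with (c * s - (c * s + - a))%C by ring.
  rewrite Hinf, Hc; ring. }
assert (HmD := proj1 (Cmod_gt_0 _) HD); assert (Hmc := proj1 (Cmod_gt_0 _) Hc).
destruct (proj1 (filterlim_locally w (w s)) (Hw s Hs) (mkposreal 1 Rlt_0_1)) as [e He].
intros U HU; apply locally_Cmod in HU; destruct HU as [eps HU].
set (D := Cmod (a * d - b * c)%C) in *; set (W := Rabs (w s) + 1).
assert (HW : 0 < W) by (unfold W; generalize (Rabs_pos (w s)); lra).
(* Three demands on [|q|], where [q = c z + d]: the first puts [t] within [e] of [s], so that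
   [|w t| < W]; the second gives [|q|^(m+n) >= 1]; the third gives [D W / |q| < eps]. *)
set (A := Rmax (D / e / Cmod c) (Rmax 1 (D * W / eps))).
destruct (Cmod_affine_large c d A Hc) as [B HB].
exists B; intros z Hz HG; specialize (HB z Hz); apply HU.
destruct HG as [t [Ht Hzt]]; symmetry in Hzt; apply Gamma_param_Fin in Hzt.
destruct Hzt as [Hn ->].
unfold omega_mn, omega, wM.
assert (Hq : (c * moebius_fun (- d) b c (- a) t + d)%C <> 0)
  by (apply moebius_denominator_Gamma_neq_0; assumption).
assert (Eq : Cmod (c * moebius_fun (- d) b c (- a) t + d)%C * (Cmod c * Rabs (t - s)) = D).
{ rewrite <- (Cmod_R (t - s)), <- !Cmod_mult, RtoC_minus, moebius_denominator_Gamma by exact Hn.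
  replace (c * (t - s))%C with (c * t + - a - (c * s + - a))%C by ring.
  rewrite Hinf; unfold D; rewrite <- Cmod_opp; f_equal; field; exact Hn. }
rewrite moebius_fun_Gamma by assumption; simpl Re.
set (q := (c * moebius_fun (- d) b c (- a) t + d)%C) in *.
assert (H1 := Rle_lt_trans _ _ _ (Rmax_l _ _) HB).
assert (H2 := Rle_lt_trans _ _ _ (Rmax_r _ _) HB).
assert (H3 := Rle_lt_trans _ _ _ (Rmax_r _ _) H2).
apply Rle_lt_trans with (1 := Rmax_l _ _) in H2.
assert (Hwt : Rabs (w t) < W).
{ assert (Hts : Rabs (t - s) < e).
  { apply (proj1 (Rlt_div_l _ _ _ Hmc)) in H1.
    apply (proj1 (Rlt_div_l _ _ _ (cond_pos e))) in H1.
    rewrite <- Eq in H1.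
    apply Rmult_lt_reg_l with (Cmod q * Cmod c); [apply Rmult_lt_0_compat; lra|].
    lra. }
  specialize (He t Hts); change (Rabs (w t - w s) < 1) in He.
  unfold W; generalize (Rabs_triang (w t - w s) (w s)).
  replace (w t - w s + w s) with (w t) by ring; lra. }
replace (_ - _)%C with ((a * d - b * c) * w t / (q ^ 2 * q ^ (m + n)))%C
  by (simpl; field; repeat split; try assumption; apply Cpow_nz, Hq).
assert (Hp : 1 <= Cmod q ^ (m + n)) by (apply pow_R1_Rle; lra).
rewrite Cmod_div, !Cmod_mult, !Cmod_pow, Cmod_R
  by (apply Cmult_neq_0; apply Cpow_nz, Hq).
fold D; set (x := Cmod q) in *; set (p := x ^ (m + n)) in *.
(* The decay comes from the square in ω alone, which includes the case [m + n = 0]. *)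
assert (Hx : x <= x ^ 2 * p) by nra.
apply (proj1 (Rlt_div_l _ _ _ (cond_pos eps))) in H3.
apply Rlt_div_l; [lra|].
assert (D * Rabs (w t) < D * W) by (apply Rmult_lt_compat_l; assumption).
assert (He0 := cond_pos eps); nra.
Qed.

Theorem theorem3 (l r : Rbar) (w : R -> R) (P : nat -> nat -> R)
    (K : nat -> R) (a b c d : C)
    (HP : orthogonal_polynomials l r w P K)
    (Hw : forall x, in_interval l r x -> w x <> 0)
    (HDelta : (a * d - b * c)%C <> RtoC 0) :
  (* M and W are mutually inverse on the extended plane *)
  (forall p : Cinf, moebius_inv a b c d (moebius a b c d p) = p /\
                    moebius a b c d (moebius_inv a b c d p) = p) /\
  (* Gamma is part of a line or circle, a curve from W(l) to W(r) *)
  (on_line_or_circle (Gamma a b c d l r) /\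
   (forall t, in_interval l r t ->
      filterlim (Gamma_param a b c d) (locally t)
        (Cinf_locally (Gamma_param a b c d t))) /\
   filterlim (Gamma_param a b c d) (left_end l)
     (Cinf_locally (moebius_inv a b c d (Rbar_to_Cinf l))) /\
   filterlim (Gamma_param a b c d) (right_end r)
     (Cinf_locally (moebius_inv a b c d (Rbar_to_Cinf r)))) /\
  (* omega = (w o M) M' on Gamma *)
  (forall z, Gamma a b c d l r (Fin z) ->
     ex_derive (K := C_AbsRing) (V := C_NormedModule) (moebius_fun a b c d) z /\
     omega w a b c d z
     = (wM w a b c d z * C_derive (moebius_fun a b c d) z)%C) /\
  (* orthogonality *)
  (forall m n : nat,
     is_contour_int
       (fun z => (R_fun P a b c d m z * R_fun P a b c d n z * omega w a b c d z)%C)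
       (Gamma_param a b c d) l r (RtoC (K m * kronecker m n)) /\
     is_contour_int
       (fun z => (Q_fun P a b c d m z * Q_fun P a b c d n z
                  * omega_mn w a b c d m n z)%C)
       (Gamma_param a b c d) l r (RtoC (K m * kronecker m n))) /\
  (* the weights do not vanish on the finite part of Gamma *)
  (forall z, Gamma a b c d l r (Fin z) ->
     omega w a b c d z <> RtoC 0 /\
     forall m n, omega_mn w a b c d m n z <> RtoC 0) /\
  (* but they vanish at infinity when Gamma passes through it *)
  (Gamma a b c d l r Infty ->
     filterlim (omega w a b c d)
       (within (fun z => Gamma a b c d l r (Fin z)) C_at_infinity)
       (locally (RtoC 0)) /\
     forall m n, filterlim (omega_mn w a b c d m n)
       (within (fun z => Gamma a b c d l r (Fin z)) C_at_infinity)
       (locally (RtoC 0))).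
Proof.
destruct HP as [Hlr Hwc _ _ _ Horth].
split; [|split; [|split; [|split; [|split]]]].
- intros p; split; [apply moebius_invK|apply moebius_invKr]; exact HDelta.
- split; [|split; [|split]].
  + apply Gamma_on_line_or_circle, HDelta.
  + intros t _; exact (Gamma_param_continuous a b c d t HDelta).
  + apply filterlim_filter_le_1 with (2 := Gamma_param_continuous a b c d l HDelta).
    apply filter_le_within.
  + apply filterlim_filter_le_1 with (2 := Gamma_param_continuous a b c d r HDelta).
    apply filter_le_within.
- intros z Hz; apply Gamma_denominator_neq_0 in Hz; [|exact HDelta].
  assert (Hd := is_derive_moebius_fun a b c d z Hz).
  split; [eexists; exact Hd|].
  rewrite (is_C_derive_unique _ _ _ Hd); unfold omega; simpl; field; exact Hz.
- intros m n.
  assert (Hc : forall t, in_interval l r t ->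
    continuous (fun x => rpoly (P m) m x * rpoly (P n) n x * w x) t).
  { intros t Ht.
    apply (continuous_mult (fun x => rpoly (P m) m x * rpoly (P n) n x) w);
      [|exact (Hwc t Ht)].
    apply (continuous_mult (rpoly (P m) m)); apply continuous_rpoly. }
  split; apply (is_contour_int_Gamma a b c d) with (5 := Horth m n); try assumption;
    intros t Ht Hn; unfold Q_fun, R_fun, omega_mn;
    rewrite omega_Gamma, moebius_fun_Gamma, !cpoly_RtoC, !RtoC_mult by assumption.
  + field; split; assumption.
  + assert (Hq := moebius_denominator_Gamma_neq_0 a b c d t HDelta Hn).
    rewrite Cpow_add_r; field; repeat split; try assumption; apply Cpow_nz, Hq.
- intros z Hz; split; [|intros m n; apply Cdiv_neq_0; [|apply Cpow_nz]].
  + exact (omega_neq_0 w a b c d z l r Hw HDelta Hz).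
  + exact (omega_neq_0 w a b c d z l r Hw HDelta Hz).
  + exact (Gamma_denominator_neq_0 a b c d z l r HDelta Hz).
- intros Hinf; split; [|intros m n; apply omega_mn_vanishes_at_infinity; assumption].
  intros U HU.
  (* ω is the weight with both indices 0, the extra power being 1. *)
  destruct (omega_mn_vanishes_at_infinity w a b c d l r 0 0 Hwc HDelta Hinf U HU)
    as [A HA].
  exists A; intros z Hz HG.
  replace (omega w a b c d z) with (omega_mn w a b c d 0 0 z); [exact (HA z Hz HG)|].
  unfold omega_mn; simpl; field.
Qed.
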